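(* Let $G=U(C_l;T_1,T_2,\ldots,T_l)$ be a graph in $\mathscr{U}_{n,l}$. Then (i) $K\!f^+(G)=4K\!f(G)+2\sum_{i=1}^l D_{T_i}(v_i)-n(n-l)$; (ii) $K\!f^*(G)=4K\!f(G)+4\sum_{i=1}^l D_{T_i}(v_i)-(2n+1)(n-l)$.
   Context: All graphs are finite, simple and undirected; $V_G,E_G$ are the vertex and edge sets of $G$, and $d(x)$ is the degree of a vertex $x$. A unicyclic graph is a connected graph $G$ with $|V_G|=|E_G|$ (so it has exactly one cycle). $\mathscr{U}_{n,l}$ is the set of all unicyclic graphs on $n$ vertices whose unique cycle is $C_l$ (the cycle of length $l$). Writing $G=U(C_l;T_1,\ldots,T_l)$ means that $C_l=v_1v_2\ldots v_lv_1$ is the unique cycle of $G$ and $T_i$ is the component of $G-E_{C_l}$ (the graph obtained from $G$ by deleting the edges of the cycle) containing $v_i$; each $T_i$ is a tree. For a tree $T$ and $v\in V_T$, $D_T(v)=\sum_{y\in V_T}d_T(v,y)$, where $d_T$ is the graph distance in $T$. The resistance distance $r(x,y)$ is the effective resistance between $x$ and $y$ when each edge of $G$ is replaced by a unit resistor. With sums over unordered pairs of vertices, the Kirchhoff index is $K\!f(G)=\sum_{\{x,y\}\subseteq V_G}r(x,y)$, the additive degree-Kirchhoff index is $K\!f^+(G)=\sum_{\{x,y\}\subseteq V_G}(d(x)+d(y))r(x,y)$, and the multiplicative degree-Kirchhoff index is $K\!f^*(G)=\sum_{\{x,y\}\subseteq V_G}d(x)d(y)r(x,y)$. *)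

(* Defs.v *)
From HB Require Import structures.
From mathcomp Require Import all_boot all_order all_algebra.
From mathcomp Require Import boolp classical_sets.

Set Implicit Arguments.
Unset Strict Implicit.
Unset Printing Implicit Defensive.

Import Order.TTheory GRing.Theory Num.Theory.
Local Open Scope ring_scope.

(* A finite simple graph on V is an adjacency relation e : rel V satisfying
   simple_graph e. *)

Section Graphs.
Variable V : finType.
Implicit Types (e : rel V) (x y z : V) (A : {set V}) (c : seq V).

Definition simple_graph e : Prop := symmetric e /\ irreflexive e.

Definition connected_graph e : Prop := forall x y, connect e x y.

Definition degree e x : nat := #|[set y | e x y]|.

Definition edges e : {set {set V}} := [set [set p.1; p.2] | p : V * V & e p.1 p.2].

Definition unicyclic e : Prop := connected_graph e /\ #|V| = #|edges e|.

(* c lists the vertices of a cycle subgraph in cyclic order; length at least 3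
   excludes the degenerate ucycles [::], [:: x] and [:: x; y]. *)
Definition graph_cycle e c : Prop := ucycle e c /\ (2 < size c)%N.

(* e is in U_{n,l}, with cycle v_1 v_2 ... v_l v_1. The cycle of a unicyclic
   graph is unique, so exhibiting one of length l pins it down. *)
Definition in_U (n l : nat) e (v : l.-tuple V) : Prop :=
  [/\ unicyclic e, #|V| = n & graph_cycle e v].

Definition cycle_edges c : {set {set V}} := [set [set x; next c x] | x in c].

Definition del_edges e (F : {set {set V}}) : rel V :=
  [rel x y | e x y && ([set x; y] \notin F)].

Definition component e x : {set V} := [set y | connect e x y].

Definition induced e A : rel V := [rel x y | [&& x \in A, y \in A & e x y]].

(* Length of a shortest path from x to y (#|V| if y is unreachable). *)
Definition dist e x y : nat :=
  find (fun k => [exists p : k.-tuple V, path e x p && (last x p == y)])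
       (iota 0 #|V|).

(* D_T(x) for the subgraph T of e induced on the vertex set A. *)
Definition dist_sum e A x : nat := (\sum_(y in A) dist (induced e A) x y)%N.

(* D_{T_i}(v_i), where T_i is the component of G - E_{C_l} containing v_i. *)
Definition D_tree (l : nat) e (v : l.-tuple V) (i : 'I_l) : nat :=
  let e' := del_edges e (cycle_edges v) in
  dist_sum e' (component e' (tnth v i)) (tnth v i).

End Graphs.

Section Resistance.
Variables (R : realFieldType) (V : finType).
Implicit Types (e : rel V) (x y z : V) (p : V -> R).

(* With unit resistors, Ohm's law gives the current p z - p w along an edge zw.
   By Kirchhoff's current law, p is the potential of a unit current entering
   the network at x and leaving it at y. *)
Definition unit_current_potential e x y p : Prop :=
  forall z, \sum_(w | e z w) (p z - p w) = (z == x)%:R - (z == y)%:R.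

(* The voltage between x and y under a unit current from x to y. On connected
   graphs it exists and is unique: see resistance_exists and resistanceE. *)
Definition resistance e x y : R :=
  xget 0 [set rho | exists2 p, unit_current_potential e x y p & rho = p x - p y]%classic.

(* enum_rank is an arbitrary linear order on V, used to count each unordered
   pair once; all the summands below are symmetric. Pairs {x, x} contribute 0. *)
Definition pair_sum (f : V -> V -> R) : R :=
  \sum_(q : V * V | (enum_rank q.1 < enum_rank q.2)%N) f q.1 q.2.

Definition Kf e : R := pair_sum (resistance e).

Definition Kf_add e : R :=
  pair_sum (fun x y => (degree e x + degree e y)%:R * resistance e x y).

Definition Kf_mul e : R :=
  pair_sum (fun x y => (degree e x * degree e y)%:R * resistance e x y).

Lemma harmonic_const e p : simple_graph e -> connected_graph e ->
  (forall z, \sum_(w | e z w) (p z - p w) = 0) -> forall x y, p x = p y.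
Proof.
move=> _ con har x0 y0.
pose m := [arg max_(i > x0) p i]%O.
have mx z : p z <= p m by rewrite /m; case: arg_maxP => // i _; apply.
have cl a z : p a = p m -> e a z -> p z = p m.
  move=> pa az; have /eqP := har a; rewrite psumr_eq0 => [|w _]; last first.
    by rewrite subr_ge0 pa mx.
  by move=> /allP /(_ z (mem_index_enum _)); rewrite az subr_eq0 pa => /eqP <-.
suff all z : p z = p m by rewrite !all.
have /connectP [s ps ->] := con m z.
have : p m = p m by [].
elim: s {1 2 4}m ps => //= b s IH a /andP[ab ps] pa.
by apply: IH ps _; apply: (cl a).
Qed.

Lemma resistance_exists e x y : simple_graph e -> connected_graph e ->
  exists p, unit_current_potential e x y p.
Proof.
move=> ge con; have [es ei] := ge.
pose L : 'M[R]_#|V| := \matrix_(i, j)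
  ((i == j)%:R * (degree e (enum_val i))%:R - (e (enum_val i) (enum_val j))%:R).
have LE (u : 'cV[R]_#|V|) z : (L *m u) (enum_rank z) 0 =
    \sum_(w | e z w) (u (enum_rank z) 0 - u (enum_rank w) 0).
  rewrite mxE; under eq_bigr do rewrite mxE mulrBl enum_rankK.
  rewrite !sumrB; congr (_ - _).
    rewrite (bigD1 (enum_rank z)) //= eqxx mul1r big1 ?addr0; last first.
      by move=> i ni; rewrite eq_sym (negbTE ni) !mul0r.
    by rewrite sumr_const /degree cardsE mulr_natl.
  rewrite [RHS]big_mkcond (reindex (@enum_val V V)) /=; last first.
    by exists enum_rank => ? _; rewrite ?enum_valK ?enum_rankK.
  apply: eq_bigr => i _; rewrite enum_valK.
  by case: (e z _); rewrite ?mul1r ?mul0r.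
have Lsym : L^T = L.
  apply/matrixP => i j; rewrite !mxE es eq_sym.
  by case: eqP => [->|_] //; rewrite !mul0r.
pose b : 'rV[R]_#|V| := delta_mx 0 (enum_rank x) - delta_mx 0 (enum_rank y).
have /submxP [u bu] : (b <= L)%MS.
  rewrite submxE; apply/eqP/matrixP => i j.
  rewrite (ord1 i) /b mulmxBl -!rowE !mxE.
  have k := mulmx_coker L.
  pose q z := col j (cokermx L) (enum_rank z) 0.
  have := @harmonic_const e q ge con _ x y.
  rewrite /q !mxE => ->; first by rewrite subrr.
  by move=> z; rewrite -LE colE mulmxA k mul0mx mxE.
exists (fun z => u^T (enum_rank z) 0) => z.
by rewrite -LE -{1}Lsym -trmx_mul -bu !mxE /= !(inj_eq enum_rank_inj).
Qed.

Lemma resistanceE e x y p : simple_graph e -> connected_graph e ->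
  unit_current_potential e x y p -> resistance e x y = p x - p y.
Proof.
move=> ge con hp; rewrite /resistance.
case: xgetP => [rho _ [q hq ->]|/(_ (p x - p y))[]]; last by exists p.
have H : q x - p x = q y - p y.
  apply: (@harmonic_const e (fun z => q z - p z)) => // z.
  transitivity (\sum_(w | e z w) ((q z - q w) - (p z - p w))).
    by apply: eq_bigr => w _; rewrite !opprD !opprK addrACA.
  by rewrite sumrB hq hp subrr.
apply/eqP; rewrite -subr_eq0.
have -> : q x - q y - (p x - p y) = q x - p x - (q y - p y).
  by rewrite !opprD !opprK addrACA.
by rewrite H subrr.
Qed.

End Resistance.

(* Main.v *)
Require Import Defs.
From mathcomp Require Import all_boot all_order all_algebra.
From mathcomp Require Import ring zify.
Import GRing.Theory Num.Theory.
Local Open Scope ring_scope.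

Set Implicit Arguments.
Unset Strict Implicit.
Unset Printing Implicit Defensive.

(** Write L for the graph Laplacian, r for the resistance distance, d for the
    degree and h(x) for the distance from x to the cycle. Weight the resistances
    from x by the excess degree: s(x) = sum_y (d(y) - 2) r(x,y). In any connected
    graph, expanding the degree products gives
      Kf^+ = 4 Kf + sum_x s(x)   and
      Kf^* = 4 Kf + 2 sum_x s(x) + (1/2) sum_x (d(x) - 2) s(x)
    ([Kf_add_excess], [Kf_mul_excess]), so everything reduces to computing s.

    Choose for each vertex off the cycle a neighbour closer to the cycle, its
    parent. The n - l edges to a parent and the l edges of the cycle are pairwise
    distinct, and G has only n edges, so these are all of them ([edgesE]). Hence
      - L h = 2 - d at every vertex ([laplacian_height]);
      - each edge off the cycle is a bridge, of resistance 1: the indicator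
        function of the descendants of its end farther from the cycle is a potential
        ([resistance_parent]);
      - sum_z h(z) (L h)(z), the sum of the squared differences of h along the
        edges, is n - l ([height_energy]).

    In any connected graph,
      (L r(x,.))(y) = 2 - sum_(w ~ y) r(y,w) - 2 [y = x]
    ([laplacian_resistance]). As L is self-adjoint,
      s(x) = - sum_y (L h)(y) r(x,y)
           = 2 h(x) - sum_y h(y) (2 - sum_(w ~ y) r(y,w)).
    Where h(y) is nonzero the inner sum is d(y), so the last term is
    sum_y h(y) (L h)(y), and s(x) = 2 h(x) - (n - l) ([excess_sumE]). Then
    sum_x s(x) = 2 sum_x h(x) - n (n - l); and since sum_x (d(x) - 2) = 0,
    sum_x (d(x) - 2) s(x) = - 2 sum_x h(x) (L h)(x) = - 2 (n - l).
    Finally the tree T_i consists of the vertices whose chain of parents ends at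
    v_i, and h is the distance to v_i in it, so sum_x h(x) = sum_i D_(T_i)(v_i)
    ([sum_D_tree]). *)

(** * The Laplacian and resistance distances *)

Section ResistanceLaplacian.
Variables (R : realFieldType) (V : finType) (e : rel V).
Hypotheses (simple_e : simple_graph e) (connected_e : connected_graph e).
Implicit Types (f g : V -> R) (x y z : V).

(** The combinatorial Laplacian of e applied to the function f. *)
Definition laplacian (f : V -> R) (z : V) : R := \sum_(w | e z w) (f z - f w).

Lemma sum_neighbor_eq z a :
  e z a -> \sum_(w | e z w) (w == a)%:R = 1 :> R.
Proof.
move=> eza; rewrite (bigD1 a) //= eqxx big1 ?addr0 // => w /andP[_].
by move/negbTE ->.
Qed.

Lemma sum_neighbor1 z : \sum_(w | e z w) 1 = (degree e z)%:R :> R.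
Proof. by rewrite sumr_const /degree cardsE. Qed.

(** The Dirichlet form of e; each edge occurs twice in the double sum. *)
Lemma laplacian_energy f g :
  \sum_z laplacian f z * g z =
  2^-1 * \sum_z \sum_(w | e z w) (f z - f w) * (g z - g w).
Proof.
have [es _] := simple_e.
have two0 : 2 != 0 :> R by rewrite pnatr_eq0.
have E1 : \sum_z laplacian f z * g z = \sum_z \sum_(w | e z w) (f z - f w) * g z.
  by apply: eq_bigr => z _; rewrite mulr_suml.
have E2 : \sum_z laplacian f z * g z = \sum_z \sum_(w | e z w) (f w - f z) * g w.
  rewrite E1 (exchange_big_dep predT) //=; apply: eq_bigr => w _.
  by apply: eq_big => // z; rewrite es.
apply: (mulfI two0); rewrite mulrA mulfV // mul1r mulr_natl mulr2n {1}E1 E2.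
rewrite -big_split /=; apply: eq_bigr => z _; rewrite -big_split /=.
by apply: eq_bigr => w _; ring.
Qed.

Lemma laplacian_selfadj f g : \sum_z laplacian f z * g z = \sum_z f z * laplacian g z.
Proof.
rewrite laplacian_energy; under [RHS]eq_bigr do rewrite mulrC.
rewrite laplacian_energy; congr (_ * _); apply: eq_bigr => z _.
by apply: eq_bigr => w _; rewrite mulrC.
Qed.

Lemma sum_laplacian0 f : \sum_z laplacian f z = 0.
Proof.
have := laplacian_selfadj f (fun=> 1); under eq_bigr do rewrite mulr1.
move=> ->; rewrite big1 // => z _.
by rewrite /laplacian big1 ?mulr0 // => w _; rewrite subrr.
Qed.

Lemma resistance_sym x y : resistance R e x y = resistance R e y x.
Proof.
have [p hp] := resistance_exists R x y simple_e connected_e.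
rewrite (resistanceE simple_e connected_e hp).
have hq : unit_current_potential e y x (fun z => - p z).
  move=> z; transitivity (- \sum_(w | e z w) (p z - p w)).
    by rewrite -sumrN; apply: eq_bigr => w _; ring.
  by rewrite hp; ring.
by rewrite (resistanceE simple_e connected_e hq); ring.
Qed.

Lemma resistance_refl x : resistance R e x x = 0.
Proof.
have [p hp] := resistance_exists R x x simple_e connected_e.
by rewrite (resistanceE simple_e connected_e hp) subrr.
Qed.

Lemma grounded_potential x y :
  exists p : V -> R, unit_current_potential e y x p /\ p x = 0.
Proof.
have [p hp] := resistance_exists R y x simple_e connected_e.
exists (fun z => p z - p x); rewrite subrr; split=> // z.
by rewrite -hp; apply: eq_bigr => w _; ring.
Qed.

(** Apart from an impulse at x, the Laplacian of y |-> r(x,y) does not depend on x: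
    only the resistances of the edges at y matter. *)
Lemma laplacian_resistance x y :
  laplacian (resistance R e x) y =
  2 - \sum_(w | e y w) resistance R e y w - 2 * (y == x)%:R.
Proof.
(* P u is the potential of a unit current from u to x with x grounded: the
   Green function of the graph grounded at x, hence symmetric; resistances
   are expressed through it by superposition. *)
have [P hP] := boolp.choice (grounded_potential x).
have hL u z : laplacian (P u) z = (z == u)%:R - (z == x)%:R := (hP u).1 z.
have P0 u : P u x = 0 := (hP u).2.
have Psym u w : P u w = P w u.
  have := laplacian_selfadj (P u) (P w).
  under eq_bigr do rewrite hL mulrBl.
  under [X in _ = X]eq_bigr do rewrite hL mulrBr.
  rewrite !sumrB.
  have sumE (a : V) (F : V -> R) : \sum_z (z == a)%:R * F z = F a.
    rewrite (bigD1 a) //= eqxx mul1r big1 ?addr0 // => z /negbTE ->.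
    by rewrite mul0r.
  under [X in _ = X - _]eq_bigr do rewrite mulrC.
  under [X in _ = _ - X]eq_bigr do rewrite mulrC.
  by rewrite !sumE !P0 !subr0 => ->.
have rE u w : resistance R e u w = P u u - P w u - P u w + P w w.
  have hp : unit_current_potential e u w (fun z => P u z - P w z).
    move=> z; have [hu _] := hP u; have [hw _] := hP w.
    transitivity (\sum_(t | e z t) (P u z - P u t)
                  - \sum_(t | e z t) (P w z - P w t)).
      by rewrite -sumrB; apply: eq_bigr => t _; ring.
    by rewrite hu hw; ring.
  by rewrite (resistanceE simple_e connected_e hp); ring.
have Pxx u : P x u = 0 by rewrite Psym P0.
transitivity (2 * laplacian (P y) y - \sum_(w | e y w) resistance R e y w).
  rewrite mulr_sumr -sumrB; apply: eq_bigr => w _.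
  rewrite !rE !Pxx !P0 (Psym w y); ring.
by rewrite hL eqxx mulrBr mulr1 addrAC.
Qed.

Lemma sum_laplacian_resistance f x :
  \sum_y laplacian f y * resistance R e x y =
  \sum_y f y * (2 - \sum_(w | e y w) resistance R e y w) - 2 * f x.
Proof.
rewrite laplacian_selfadj; under eq_bigr do rewrite laplacian_resistance mulrBr.
rewrite sumrB; congr (_ - _).
rewrite (bigD1 x) //= eqxx big1 => [|y /negbTE ->]; last by rewrite !mulr0.
by rewrite mulr1 addr0 mulrC.
Qed.

(** A set S of vertices separated from its complement by the single edge yw, with
    y in S: the hypothesis says that the indicator function of S jumps along yw
    and along no other edge. This indicator function is then a potential of a
    unit current from y to w. *)
Lemma bridge_resistance (S : pred V) y w :
  (forall a b, e a b -> (S a)%:R - (S b)%:R =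
     ((a == y) && (b == w))%:R - ((a == w) && (b == y))%:R :> R) ->
  e y w -> resistance R e y w = 1.
Proof.
move=> hS eyw; have [es ei] := simple_e.
have sumE a b u : e b a -> \sum_(t | e u t) ((u == b) && (t == a))%:R = (u == b)%:R :> R.
  move=> eba; case: eqP => [->|_] /=; last by rewrite big1.
  exact: sum_neighbor_eq.
have hp : unit_current_potential e y w (fun z => (S z)%:R : R).
  move=> z; under eq_bigr do rewrite hS //.
  by rewrite sumrB !sumE // es.
rewrite (resistanceE simple_e connected_e hp) hS // !eqxx.
have /negbTE -> : y != w by apply: contraTneq eyw => ->; rewrite ei.
by rewrite subr0.
Qed.

(** Summing a symmetric function over ordered pairs counts each pair twice. *)
Lemma double_sum_pair_sum (F : V -> V -> R) :
  (forall x y, F x y = F y x) -> (forall x, F x x = 0) ->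
  \sum_x \sum_y F x y = 2 * pair_sum F.
Proof.
move=> Fs F0; rewrite /pair_sum mulr_natl mulr2n pair_bigA /=.
rewrite (bigID (fun q : V * V => (enum_rank q.1 < enum_rank q.2)%N)) /=.
congr (_ + _).
rewrite (bigID (fun q : V * V => q.1 == q.2)) /= big1 ?add0r; last first.
  by move=> q /andP[_ /eqP ->].
rewrite (reindex (fun q : V * V => (q.2, q.1))) /=; last first.
  by exists (fun q : V * V => (q.2, q.1)) => -[].
apply: eq_big => [[x y]|[x y] _] /=; last exact: Fs.
rewrite -leqNgt ltn_neqAle andbC; congr (_ && _).
by rewrite eq_sym -(inj_eq enum_rank_inj).
Qed.

(** * Reduction to the excess sums *)

Let rho := resistance R e.
Let deg x : R := (degree e x)%:R.
(** Resistances from x weighted by the excess d(y) - 2 of the degrees over their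
    average, which is 2 in a unicyclic graph. *)
Definition excess_sum x := \sum_y (deg y - 2) * rho x y.

Lemma double_sum_Kf : \sum_x \sum_y rho x y = 2 * Kf R e.
Proof. exact: double_sum_pair_sum resistance_sym resistance_refl. Qed.

Lemma double_sum_Kf_add :
  \sum_x \sum_y (deg x + deg y) * rho x y = 2 * Kf_add R e.
Proof.
rewrite /Kf_add -double_sum_pair_sum => [|x y|x].
- by apply: eq_bigr => x _; apply: eq_bigr => y _; rewrite natrD.
- by rewrite resistance_sym addnC.
- by rewrite resistance_refl mulr0.
Qed.

Lemma double_sum_Kf_mul :
  \sum_x \sum_y deg x * deg y * rho x y = 2 * Kf_mul R e.
Proof.
rewrite /Kf_mul -double_sum_pair_sum => [|x y|x].
- by apply: eq_bigr => x _; apply: eq_bigr => y _; rewrite natrM.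
- by rewrite resistance_sym mulnC.
- by rewrite resistance_refl mulr0.
Qed.

Lemma Kf_add_excess : Kf_add R e = 4 * Kf R e + \sum_x excess_sum x.
Proof.
have two0 : 2 != 0 :> R by rewrite pnatr_eq0.
apply: (mulfI two0); rewrite -double_sum_Kf_add.
transitivity (\sum_x \sum_y (deg x - 2) * rho x y +
   \sum_x excess_sum x + 4 * \sum_x \sum_y rho x y).
  rewrite mulr_sumr -!big_split /=; apply: eq_bigr => x _.
  rewrite mulr_sumr -!big_split /=; apply: eq_bigr => y _; ring.
have -> : \sum_x \sum_y (deg x - 2) * rho x y = \sum_x excess_sum x.
  rewrite exchange_big; apply: eq_bigr => x _; apply: eq_bigr => y _.
  by rewrite /rho resistance_sym.
rewrite double_sum_Kf; ring.
Qed.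

Lemma Kf_mul_excess :
  Kf_mul R e = 4 * Kf R e + 2 * \sum_x excess_sum x
               + 2^-1 * \sum_x (deg x - 2) * excess_sum x.
Proof.
have two0 : 2 != 0 :> R by rewrite pnatr_eq0.
apply: (mulfI two0); rewrite -double_sum_Kf_mul.
rewrite !mulrDr [_ * (2^-1 * _)]mulrA mulfV // mul1r.
transitivity (\sum_x (deg x - 2) * excess_sum x +
    2 * (\sum_x \sum_y (deg x + deg y) * rho x y) +
    - 4 * \sum_x \sum_y rho x y); last first.
  by rewrite double_sum_Kf_add Kf_add_excess double_sum_Kf; ring.
rewrite !mulr_sumr -!big_split /=; apply: eq_bigr => x _.
rewrite !mulr_sumr -!big_split /=; apply: eq_bigr => y _; ring.
Qed.

End ResistanceLaplacian.

(** * Distance to a set of vertices *)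

Section DistanceToSet.
Local Open Scope nat_scope.
Variables (V : finType) (e : rel V) (A : pred V).

(** Length of a shortest path from x into A (#|V| if there is none). For A = {y}
    this is convertible to the graph distance from x to y. *)
Definition set_dist x : nat :=
  find (fun k => [exists p : k.-tuple V, path e x p && (last x p \in A)])
       (iota 0 #|V|).

Lemma set_dist_le_path x p :
  path e x p -> last x p \in A -> set_dist x <= size p.
Proof.
move=> ep lp; rewrite /set_dist leqNgt; apply/negP => lt_p.
have sz : size p < #|V|.
  by apply: leq_trans lt_p _; rewrite -[X in _ <= X](size_iota 0) find_size.
have := before_find 0 lt_p; rewrite nth_iota // add0n => /existsP[].
by exists (in_tuple p); rewrite /= ep.
Qed.

(** The minimum is attained by some path. *)
Lemma set_distP x p : path e x p -> last x p \in A ->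
  exists2 q, path e x q & last x q \in A /\ size q = set_dist x.
Proof.
move=> ep; case/shortenP: ep => q eq uq _ lq.
(* A path without repetition has fewer than #|V| edges, so the search that
   defines set_dist succeeds. *)
have sz : size q < #|V|.
  by rewrite -[(size q).+1]/(size (x :: q)) -(card_uniqP uq) max_card.
have lt_d : set_dist x < size (iota 0 #|V|).
  by rewrite size_iota; apply: leq_ltn_trans (set_dist_le_path eq lq) sz.
have := nth_find 0 (etrans (has_find _ _) lt_d).
rewrite -/(set_dist x) nth_iota; last by rewrite size_iota in lt_d.
rewrite add0n => /existsP[r /andP[er lr]].
by exists r => //; rewrite size_tuple.
Qed.

End DistanceToSet.

(** * Edges of a cycle *)

Section Cycle.
Local Open Scope nat_scope.
Variables (V : finType) (c : seq V).
Hypotheses (uniq_c : uniq c) (size_c : 2 < size c).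

Lemma next_next_neq x : x \in c -> next c (next c x) != x.
Proof.
move=> cx; have [i c' rc] := rot_to cx.
rewrite -!(next_rot i uniq_c) rc.
have: uniq (x :: c') by rewrite -rc rot_uniq.
have: 2 < size (x :: c') by rewrite -rc size_rot.
case: c' {rc} => [|b [|d c']] //= _; rewrite !inE !negb_or eqxx.
case/and4P=> /and3P[xb xd _] /andP[bd _] _ _.
by rewrite [b == x]eq_sym (negbTE xb) eqxx eq_sym.
Qed.

Lemma card_cycle_edges : #|cycle_edges c| = size c.
Proof.
rewrite /cycle_edges card_in_imset ?(card_uniqP uniq_c) // => x y cx cy exy.
have : x \in [set y; next c y] by rewrite -exy set21.
have : next c x \in [set y; next c y] by rewrite -exy set22.
rewrite !in_set2 => /orP[/eqP nx|/eqP nx] /orP[/eqP //|/eqP xn].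
  by have := next_next_neq cy; rewrite -xn nx eqxx.
by rewrite -(prev_next uniq_c x) nx prev_next.
Qed.

Lemma next_neq_prev x : x \in c -> next c x != prev c x.
Proof.
move=> cx; apply: contra_neq (next_next_neq cx) => ->.
exact: next_prev.
Qed.

Lemma mem_cycle_edges x y :
  ([set x; y] \in cycle_edges c) =
  [&& x \in c, y \in c & (next c x == y) || (next c y == x)].
Proof.
apply/imsetP/and3P => [[z cz exy]|[cx cy /orP[]/eqP nxy]].
- have nz : next c z \in c by rewrite mem_next.
  have : x \in [set z; next c z] by rewrite -exy set21.
  have : y \in [set z; next c z] by rewrite -exy set22.
  have : z \in [set x; y] by rewrite exy set21.
  have : next c z \in [set x; y] by rewrite exy set22.
  rewrite !in_set2 => nxy zxy /orP[]/eqP yz /orP[]/eqP xz; subst x y;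
    rewrite ?cz ?nz ?eqxx ?orbT //.
  by move: zxy; rewrite orbb => /eqP zxy; rewrite -!zxy eqxx.
- by apply/imsetP; rewrite -nxy; apply: imset_f.
- by apply/imsetP; rewrite setUC -nxy; apply: imset_f.
Qed.

End Cycle.

(** * Structure of a unicyclic graph *)

Section UnicyclicStructure.
Local Open Scope nat_scope.
Variables (V : finType) (e : rel V) (c : seq V).
Hypotheses (simple_e : simple_graph e) (unicyclic_e : unicyclic e)
  (cycle_c : graph_cycle e c).

Let es : symmetric e := simple_e.1.
Let ei : irreflexive e := simple_e.2.
Let connected_e : connected_graph e := unicyclic_e.1.
Let uniq_c : uniq c. Proof. by case: cycle_c => /andP[]. Qed.
Let size_c : 2 < size c := cycle_c.2.

(** Distance to the cycle. *)
Definition height : V -> nat := set_dist e [in c].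

Let nonempty_c : exists x, x \in c.
Proof. by case: c size_c => [|a c'] //; exists a; rewrite mem_head. Qed.

Lemma path_height x :
  exists2 p, path e x p & last x p \in c /\ size p = height x.
Proof.
have [a ca] := nonempty_c; have /connectP[p ep lp] := connected_e x a.
by apply: (@set_distP _ _ [in c] _ p) => //; rewrite -lp.
Qed.

Lemma height_eq0 x : (height x == 0) = (x \in c).
Proof.
apply/eqP/idP => [h0|cx]; last first.
  by apply/eqP; rewrite -leqn0 (@set_dist_le_path _ e [in c] x [::]).
by have [p _ [lp]] := path_height x; rewrite h0 => /size0nil p0; move: lp; rewrite p0.
Qed.

Lemma height_edge x w : e x w -> height x <= (height w).+1.
Proof.
move=> xw; have [p ep [lp <-]] := path_height w.
by apply: (@set_dist_le_path _ e [in c] x (w :: p)); rewrite //= xw.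
Qed.

(** A chosen neighbour of x one step closer to the cycle; by convention, vertices
    of the cycle are their own parent, so that iterating [parent] stops there. *)
Definition parent x : V :=
  if x \in c then x else odflt x [pick w | e x w && (height x == (height w).+1)].

Lemma parentP x : x \notin c -> e x (parent x) /\ height x = (height (parent x)).+1.
Proof.
move=> ncx; rewrite /parent (negbTE ncx); case: pickP => [w /andP[-> /eqP] //|no].
have [[|w p] /= ep [lp sz]] := path_height x; first by rewrite lp in ncx.
move/andP: ep => [xw ep]; have /negP[] := no w; rewrite xw /= eqn_leq.
rewrite height_edge //= -sz ltnS.
exact: (@set_dist_le_path _ e [in c] w p).
Qed.

Lemma edge_parent x : x \notin c -> e x (parent x).
Proof. by case/parentP. Qed.

Lemma height_parent x : x \notin c -> height x = (height (parent x)).+1.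
Proof. by case/parentP. Qed.

(** Height increases by at most the length of a path. *)
Lemma height_path x p : path e x p -> height (last x p) <= height x + size p.
Proof.
elim: p x => [|w p IH] x /=; first by rewrite addn0.
case/andP=> xw /IH /leq_trans; apply.
by rewrite addnS -addSn leq_add2r height_edge // es.
Qed.

(** Off the cycle, no two vertices are each other's parent. *)
Lemma parent_antisym x y : x \notin c -> y \notin c -> x = parent y -> y != parent x.
Proof.
move=> ncx ncy xy; apply/eqP => yx.
by have := height_parent ncx; have := height_parent ncy; rewrite -xy -yx; lia.
Qed.

Lemma parent_id x : x \in c -> parent x = x.
Proof. by rewrite /parent => ->. Qed.

Definition parent_edges : {set {set V}} :=
  [set [set x; parent x] | x in [predC [in c]]].

Lemma card_parent_edges : #|parent_edges| = #|V| - size c.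
Proof.
rewrite card_in_imset.
  by rewrite -(cardC [in c]) (card_uniqP uniq_c) addKn.
move=> x y; rewrite !inE => ncx ncy exy.
have : x \in [set y; parent y] by rewrite -exy set21.
have : y \in [set x; parent x] by rewrite exy set21.
rewrite !in_set2 => /orP[/eqP //|/eqP yp] /orP[/eqP //|/eqP xp].
have := height_parent ncx; have := height_parent ncy.
by rewrite -yp -xp => ->; lia.
Qed.

Lemma cycle_next x : x \in c -> e x (next c x).
Proof. by move=> cx; apply: next_cycle cx; case: cycle_c => /andP[]. Qed.

Lemma cycle_prev x : x \in c -> e x (prev c x).
Proof. by move=> cx; rewrite es -{2}(next_prev uniq_c x) cycle_next // mem_prev. Qed.

(** The cycle edges and the parent edges are disjoint families of edges, l and
    n - l in number; as there are n edges in all, no others exist. *)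
Lemma edgesE : edges e = cycle_edges c :|: parent_edges.
Proof.
apply/esym/eqP; rewrite eqEcard; apply/andP; split.
  apply/subsetP => _ /setUP[] /imsetP[x cx ->].
    by apply/imsetP; exists (x, next c x); rewrite // inE cycle_next.
  by apply/imsetP; exists (x, parent x); rewrite // inE edge_parent.
have dis : [disjoint cycle_edges c & parent_edges].
  apply/pred0P => F0 /=; apply/negP => /andP[cF /imsetP[x ncx F]].
  by move: cF; rewrite F mem_cycle_edges // (negbTE ncx).
have [_ <-] := unicyclic_e.
rewrite cardsU (disjoint_setI0 dis) cards0 subn0.
rewrite card_cycle_edges // card_parent_edges subnKC //.
by rewrite -(card_uniqP uniq_c) max_card.
Qed.

Lemma edgeE x w :
  e x w = [|| [&& x \in c, w \in c & (w == next c x) || (w == prev c x)],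
              (x \notin c) && (w == parent x)
            | (w \notin c) && (x == parent w)].
Proof.
apply/idP/or3P => [exw|[/and3P[cx cw /orP[]/eqP ->]|/andP[ncx /eqP ->]|]].
- have : [set x; w] \in edges e by apply/imsetP; exists (x, w); rewrite // inE.
  rewrite edgesE => /setUP[]; last first.
    case/imsetP=> y ncy exy; have nxw : x != w.
      by apply: contraTneq exw => ->; rewrite ei.
    have : x \in [set y; parent y] by rewrite -exy set21.
    have : w \in [set y; parent y] by rewrite -exy set22.
    rewrite !in_set2 => /orP[]/eqP wy /orP[]/eqP xy; subst x w.
    + by rewrite eqxx in nxw.
    + by constructor 3; rewrite eqxx andbT.
    + by constructor 2; rewrite eqxx andbT.
    + by rewrite eqxx in nxw.
  rewrite mem_cycle_edges // => /and3P[cx cw nxw]; constructor 1.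
  rewrite cx cw /=; case/orP: nxw => /eqP <-; first by rewrite eqxx.
  by rewrite prev_next // eqxx orbT.
- exact: cycle_next.
- exact: cycle_prev.
- exact: edge_parent.
- by case/andP=> ncw /eqP ->; rewrite es edge_parent.
Qed.

(** The end of the chain of parents of x: the vertex of the cycle where the tree
    containing x is attached. *)
Definition root x : V := iter (height x) parent x.

Lemma root_parent x : x \notin c -> root x = root (parent x).
Proof. by move=> ncx; rewrite /root height_parent // iterSr. Qed.

Lemma root_id x : x \in c -> root x = x.
Proof. by rewrite /root -height_eq0 => /eqP ->. Qed.

Lemma parent_ind (P : V -> Prop) :
  (forall x, x \in c -> P x) ->
  (forall x, x \notin c -> P (parent x) -> P x) -> forall x, P x.
Proof.
move=> P0 PS x; have [k] := ubnP (height x).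
elim: k x => // k IH x; case: (boolP (x \in c)) => [/P0 //|ncx].
by rewrite ltnS => hx; apply: PS => //; apply: IH; rewrite -height_parent.
Qed.

Lemma root_in x : root x \in c.
Proof.
elim/parent_ind: x => x cx; first by rewrite root_id.
by rewrite (root_parent cx).
Qed.

(* The graph without its cycle edges: the disjoint union of the trees. *)
Let forest := del_edges e (cycle_edges c).

Lemma forestE x w : forest x w =
  ((x \notin c) && (w == parent x)) || ((w \notin c) && (x == parent w)).
Proof.
rewrite /forest /del_edges /= mem_cycle_edges // edgeE.
apply/andP/idP => [[/orP[/and3P[-> -> /= /orP[]/eqP ->]|//]]|].
- by rewrite eqxx.
- by rewrite next_prev // eqxx orbT.
move=> H; rewrite H orbT; split=> //.
by case/orP: H => /andP[/negbTE -> _]; rewrite // andbF.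
Qed.

Lemma root_forest x w : forest x w -> root x = root w.
Proof.
rewrite forestE => /orP[]/andP[nc /eqP ->]; first exact: root_parent.
by rewrite -root_parent.
Qed.

Lemma forest_sym : symmetric forest.
Proof. by move=> x w; rewrite !forestE orbC. Qed.

Lemma component_root x : x \in c -> component forest x = [set y | root y == x].
Proof.
move=> cx; apply/setP => y; rewrite !inE; apply/idP/eqP.
  have cl : closed forest [pred z | root z == x].
    by move=> a b ab; rewrite !inE (root_forest ab).
  by move=> /(closed_connect cl); rewrite !inE root_id // eqxx => /esym/eqP.
move=> <-; elim/parent_ind: y {cx} => y cy; first by rewrite root_id.
rewrite -root_parent // => /connect_trans; apply; apply: connect1.
by rewrite forest_sym forestE cy eqxx.
Qed.

(** The chain of parents of y is a path of length [height y] inside the tree, and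
    no path from the cycle to y is shorter, even in the whole graph. *)
Lemma dist_component x y : x \in c -> root y = x ->
  dist (induced forest (component forest x)) x y = height y.
Proof.
move=> cx; rewrite component_root //; set T := [set _ | _].
move=> ry; change (set_dist (induced forest T) (pred1 y) x = height y).
have [p ep [lp sz]] : exists2 p, path (induced forest T) x p &
    last x p = y /\ size p = height y.
  elim/parent_ind: y ry => y cy ry.
    exists [::] => //=; move: (cy); rewrite -height_eq0 => /eqP ->.
    by rewrite -ry root_id.
  move=> ryx; have [p ep [lp sz]] := ry (etrans (esym (root_parent cy)) ryx).
  exists (rcons p y); last by rewrite last_rcons size_rcons sz -height_parent.
  rewrite rcons_path ep lp /induced /= /T !inE -(root_parent cy) ryx eqxx.
  by rewrite forestE cy eqxx orbT.
apply/eqP; rewrite eqn_leq -{1}sz set_dist_le_path //=; last by rewrite lp inE.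
have [|q eq [/eqP lq <-]] := @set_distP _ (induced forest T) (pred1 y) _ _ ep.
  by rewrite lp inE.
have hx : height x = 0 by apply/eqP; rewrite height_eq0.
rewrite -lq -[size q]add0n -hx; apply: height_path.
by apply: sub_path eq => a b /and3P[_ _ /andP[]].
Qed.

End UnicyclicStructure.

(** * Resistances in a unicyclic graph *)

Section UnicyclicResistance.
Variables (R : realFieldType) (V : finType) (e : rel V) (c : seq V).
Hypotheses (simple_e : simple_graph e) (unicyclic_e : unicyclic e)
  (cycle_c : graph_cycle e c).

Local Notation height := (height e c).
Local Notation parent := (parent e c).
Let h x : R := (height x)%:R.
Let edgeE := edgeE simple_e unicyclic_e cycle_c.
Let height_eq0 := height_eq0 unicyclic_e cycle_c.
Let edge_parent := edge_parent unicyclic_e cycle_c.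
Let height_parent := height_parent unicyclic_e cycle_c.
Let parent_antisym := parent_antisym unicyclic_e cycle_c.
Let connected_e : connected_graph e := unicyclic_e.1.

Lemma height_cycle x : x \in c -> h x = 0.
Proof. by rewrite /h -height_eq0 => /eqP ->. Qed.

(** Off the cycle, z has one neighbour of smaller height, its parent, and d(z) - 1
    of larger height; on the cycle, it has two neighbours of height 0 and d(z) - 2
    of height 1. *)
Lemma laplacian_height z : laplacian e h z = 2 - (degree e z)%:R.
Proof.
rewrite -sum_neighbor1; have [cz|ncz] := boolP (z \in c).
  have uc : uniq c by case: cycle_c => /andP[].
  have np := negbTE (next_neq_prev uc cycle_c.2 cz).
  transitivity (\sum_(w | e z w) (w == next c z)%:R
     + \sum_(w | e z w) (w == prev c z)%:R - \sum_(w | e z w) 1 : R); last first.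
    by rewrite !sum_neighbor_eq // ?(cycle_next cycle_c) ?(cycle_prev simple_e cycle_c).
  rewrite -big_split -sumrB /=; apply: eq_bigr => w.
  rewrite edgeE cz /= height_cycle // => /orP[/andP[cw]|/andP[ncw /eqP pw]].
    rewrite height_cycle // => /orP[]/eqP ->; rewrite eqxx.
      by rewrite np addr0 !subrr.
    by rewrite eq_sym np subrr add0r subrr.
  have -> : h w = 1 by rewrite /h height_parent // -pw -natr1 -/(h z) height_cycle ?add0r.
  have /negbTE -> : w != next c z by apply: contraNneq ncw => ->; rewrite mem_next.
  have /negbTE -> : w != prev c z by apply: contraNneq ncw => ->; rewrite mem_prev.
  by rewrite !mulr0n; ring.
transitivity (2 * \sum_(w | e z w) (w == parent z)%:R - \sum_(w | e z w) 1 : R);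
  last by rewrite sum_neighbor_eq ?mulr1 ?edge_parent.
rewrite mulr_sumr -sumrB.
apply: eq_bigr => w; rewrite edgeE (negbTE ncz) /= => /orP[/eqP ->|/andP[ncw /eqP pw]].
  by rewrite eqxx /h height_parent // -natr1 mulr1n; ring.
have /negbTE -> : w != parent z by apply: parent_antisym.
by rewrite /h (height_parent ncw) -pw -natr1 mulr0n; ring.
Qed.

Lemma height_energy :
  \sum_z laplacian e h z * h z = #|V|%:R - (size c)%:R.
Proof.
have two0 : 2 != 0 :> R by rewrite pnatr_eq0.
have [es _] := simple_e.
rewrite laplacian_energy //; apply: (mulfI two0); rewrite mulrA mulfV // mul1r.
(* up z w is 1 when zw is the parent edge of z. Each parent edge contributes to
   the double sum of squares once as up z w and once as up w z. *)
pose up z w : R := ((z \notin c) && (w == parent z))%:R.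
have up_sum : \sum_z \sum_(w | e z w) up z w = #|V|%:R - (size c)%:R.
  have uc : uniq c by case: cycle_c => /andP[].
  rewrite -(card_uniqP uc) -(cardC [in c]) natrD addrC addKr.
  rewrite -sumr_const [RHS]big_mkcond; apply: eq_bigr => z _.
  rewrite /up inE /=; case: (boolP (z \in c)) => [|ncz] /=; first by rewrite big1.
  by rewrite sum_neighbor_eq // edge_parent.
have down_sum : \sum_z \sum_(w | e z w) up w z = #|V|%:R - (size c)%:R.
  rewrite -up_sum (exchange_big_dep predT) //=; apply: eq_bigr => w _.
  by apply: eq_big => // z; rewrite es.
rewrite mulr_natl mulr2n -{1}up_sum -down_sum.
rewrite -big_split /=; apply: eq_bigr => z _; rewrite -big_split /=.
have down z' w : z' \notin c -> w = parent z' ->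
    (h z' - h w) * (h z' - h w) = up z' w + up w z'.
  move=> ncz wz; have -> : up w z' = 0.
    rewrite /up; have [//|ncw] := boolP (w \in c).
    by rewrite (negbTE (parent_antisym ncw ncz wz)).
  by rewrite /up ncz wz eqxx /h (height_parent ncz) -natr1 mulr1n; ring.
apply: eq_bigr => w; rewrite edgeE => /or3P[/and3P[cz cw _]|/andP[nc /eqP]|/andP[nc /eqP]].
- by rewrite !height_cycle // /up cz cw subrr mul0r addr0.
- exact: down.
- by move=> zw; rewrite -[LHS]mulrNN opprB addrC; apply: down.
Qed.

Lemma fconnect_parent_height a y : fconnect parent a y -> (height y <= height a)%N.
Proof.
move/iter_findex <-; elim: (findex _ _ _) => //= k /(leq_trans _); apply.
set x := iter _ _ _; have [cx|ncx] := boolP (x \in c).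
  by rewrite parent_id.
by rewrite (height_parent ncx).
Qed.

(** The set cut off by the edge from y to its parent consists of the descendants
    of y. *)
Lemma resistance_parent y : y \notin c -> resistance R e y (parent y) = 1.
Proof.
move=> ncy; apply: (@bridge_resistance _ _ _ simple_e connected_e
  (fun x => fconnect parent x y)); last exact: edge_parent.
have cyc a : a \in c -> fconnect parent a y = false.
  move=> ca; apply: contraNF ncy => /fconnect_parent_height.
  rewrite -height_eq0; move: ca; rewrite -height_eq0 => /eqP ->.
  by rewrite leqn0.
have up a : a \notin c -> (fconnect parent a y)%:R - (fconnect parent (parent a) y)%:R
    = ((a == y) && (parent a == parent y))%:R - ((a == parent y) && (parent a == y))%:R :> R.
  move=> nca; have /negbTE -> : ~~ ((a == parent y) && (parent a == y)).
    apply/negP => /andP[/eqP ay /eqP ya].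
    by have := parent_antisym nca ncy ay; rewrite ya eqxx.
  rewrite [fconnect parent a y]fconnect_eqVf; case: (eqVneq a y) => [->|_] /=.
    have /negbTE -> : ~~ fconnect parent (parent y) y; last by rewrite eqxx.
    by apply/negP => /fconnect_parent_height; rewrite (height_parent ncy); lia.
  by rewrite !subrr.
move=> a b; rewrite edgeE => /or3P[/and3P[ca cb _]|/andP[nca /eqP ->]|/andP[ncb /eqP ->]].
- rewrite !cyc //; have /negbTE -> : a != y by apply: contraNneq ncy => <-.
  have /negbTE -> : b != y by apply: contraNneq ncy => <-.
  by rewrite andbF.
- exact: up.
- by rewrite -opprB up // opprB [(b == y) && _]andbC [(b == parent y) && _]andbC.
Qed.

Lemma resistance_off_cycle y w : y \notin c -> e y w -> resistance R e y w = 1.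
Proof.
move=> ncy; rewrite edgeE (negbTE ncy) /= => /orP[/eqP ->|/andP[ncw /eqP ->]].
  exact: resistance_parent.
by rewrite resistance_sym // resistance_parent.
Qed.

(** The key formula s(x) = 2 h(x) - (n - l). *)
Lemma excess_sumE x :
  excess_sum R e x = 2 * h x - (#|V|%:R - (size c)%:R).
Proof.
transitivity (- \sum_y laplacian e h y * resistance R e x y).
  by rewrite -sumrN; apply: eq_bigr => y _; rewrite laplacian_height -mulNr opprB.
rewrite sum_laplacian_resistance // opprB -height_energy; congr (_ - _).
apply: eq_bigr => y _; have [cy|ncy] := boolP (y \in c).
  by rewrite height_cycle // mul0r mulr0.
rewrite mulrC laplacian_height -sum_neighbor1; congr ((_ - _) * _).
by apply: eq_bigr => w; apply: resistance_off_cycle.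
Qed.

Lemma sum_excess_sum :
  \sum_x excess_sum R e x =
  2 * (\sum_x height x)%N%:R - #|V|%:R * (#|V|%:R - (size c)%:R).
Proof.
rewrite (eq_bigr _ (fun x _ => excess_sumE x)).
by rewrite sumrB -mulr_sumr -natr_sum sumr_const -[X in _ - X]mulr_natl.
Qed.

Lemma sum_deg_excess_sum :
  \sum_x ((degree e x)%:R - 2) * excess_sum R e x =
  - 2 * (#|V|%:R - (size c)%:R).
Proof.
pose K : R := #|V|%:R - (size c)%:R; rewrite -/K.
transitivity (- 2 * \sum_x laplacian e h x * h x + K * \sum_x laplacian e h x).
  rewrite !mulr_sumr -big_split /=; apply: eq_bigr => x _.
  by rewrite excess_sumE laplacian_height -/K; ring.
by rewrite (sum_laplacian0 simple_e) mulr0 addr0 height_energy.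
Qed.

End UnicyclicResistance.

(** * Kirchhoff indices of a unicyclic graph *)

(** Every vertex lies in exactly one tree, the one attached at its root. *)
Lemma sum_D_tree (l : nat) (V : finType) (e : rel V) (v : l.-tuple V) :
  simple_graph e -> unicyclic e -> graph_cycle e v ->
  (\sum_(i < l) D_tree e v i)%N = (\sum_x height e v x)%N.
Proof.
move=> se ue gc; have uv : uniq v by case: gc => /andP[].
transitivity (\sum_(i < l) \sum_(y | root e v y == tnth v i) height e v y)%N.
  apply: eq_bigr => i _; have vi := mem_tnth i v.
  rewrite /D_tree /dist_sum; apply: eq_big => y.
    by rewrite component_root // inE.
  by rewrite component_root // inE => /eqP ry; rewrite -component_root // dist_component.
rewrite (exchange_big_dep predT) //=; apply: eq_bigr => y _.
have /tnthP[i yi] := root_in ue gc y.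
rewrite (big_pred1 i) // => j /=.
by rewrite yi (inj_eq (tuple_uniqP _ uv)) eq_sym.
Qed.

Theorem theorem1p3 (R : realFieldType) (n l : nat) (V : finType) (e : rel V)
    (v : l.-tuple V) :
  simple_graph e -> in_U n e v ->
  Kf_add R e = 4%:R * Kf R e + 2%:R * (\sum_(i < l) (D_tree e v i)%:R)
               - n%:R * (n%:R - l%:R)
  /\
  Kf_mul R e = 4%:R * Kf R e + 4%:R * (\sum_(i < l) (D_tree e v i)%:R)
               - (2%:R * n%:R + 1) * (n%:R - l%:R).
Proof.
move=> se [ue <- gc]; have con : connected_graph e := ue.1.
have two0 : 2 != 0 :> R by rewrite pnatr_eq0.
rewrite Kf_add_excess // Kf_mul_excess // (sum_deg_excess_sum R se ue gc).
rewrite (sum_excess_sum R se ue gc) size_tuple -natr_sum (sum_D_tree se ue gc).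
rewrite mulrA mulrN mulVf //; split; ring.
Qed.
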